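(* Let $X = x_1,\ldots,x_n$ be a time series and $\epsilon \ge 0$. The set $\tilde{X}$ of line segments output by Algorithm SegmentBound on $X$ with error bound $\epsilon$ satisfies $segerr(X,\tilde{X}) \le \epsilon$, and $|\tilde{X}|$ equals the minimum number of segments of any piecewise linear approximation $\tilde{Y}$ of $X$ with $segerr(X,\tilde{Y}) \le \epsilon$.
   Context: A line segment is $s=((i,y_i),(j,y_j))$ with integers $i<j$ and reals $y_i,y_j$; $[i,j]$ is its range, and it approximates index $k\in[i,j]$ by $\tilde{x}_k = y_i + \frac{k-i}{j-i}(y_j-y_i)$. A set of segments $\tilde{X}$ is a piecewise linear approximation (PLA) of $X = x_1,\ldots,x_n$ if for every index $1\le k\le n$, either $k$ lies in the range of exactly one segment of $\tilde{X}$, or there are two segments of $\tilde{X}$ sharing the same endpoint at index $k$. Define $segerr(X,\tilde{X}) = \max_{s\in\tilde{X}} \sum_{k\in range(s)} (x_k - \tilde{x}_k)^2$, where $\tilde{x}_k$ is the approximation given by $s$. For points $x_i,\ldots,x_j$ the least-squares segment is the segment with range $[i,j]$ whose underlying line minimizes $\sum_{k=i}^j (x_k-\tilde{x}_k)^2$. Algorithm SegmentBound: set $i=1$, $j=3$, $s=((1,x_1),(2,x_2))$. Repeat: let $s'$ be the least-squares segment for $x_i,\ldots,x_j$; if its error $\sum_{k=i}^j(x_k-\tilde{x}_k)^2\le\epsilon$, set $s=s'$, $j=j+1$; otherwise output $s$, set $i=j$, $j=j+2$, $s=((i,x_i),(i+1,x_{i+1}))$. When the input ends, the current $s$ is output.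 *)

(* Defs.v *)
From HB Require Import structures.
From mathcomp Require Import all_boot all_order all_algebra.
From mathcomp Require Import finmap.
From mathcomp Require Import boolp classical_sets.

Set Implicit Arguments.
Unset Strict Implicit.
Unset Printing Implicit Defensive.

Import Order.TTheory GRing.Theory Num.Theory.

Local Open Scope ring_scope.

(* The pair ((i, y_i), (j, y_j)); the requirement i < j is [wf_segment]. *)
Notation segment R := ((int * R) * (int * R))%type.

(* A time series x_1, ..., x_n is a function [x : nat -> R] together with its
   length [n]; no value of [x] outside 1..n is part of the data. *)

Section PiecewiseLinear.
Variable R : realFieldType.
Implicit Types (x : nat -> R) (n : nat) (s t : segment R) (k : int).
Implicit Type Y : {fset segment R}.

Definition wf_segment s : bool := s.1.1 < s.2.1.

Definition in_range s k : bool := s.1.1 <= k <= s.2.1.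

Definition approx s k : R :=
  s.1.2 + (k - s.1.1)%:~R / (s.2.1 - s.1.1)%:~R * (s.2.2 - s.1.2).

Definition endpoint s (p : int * R) : Prop := p = s.1 \/ p = s.2.

Definition is_PLA n Y : Prop :=
  (forall s, s \in Y -> wf_segment s) /\
  (forall k : nat, (1 <= k <= n)%N ->
     (exists! s, s \in Y /\ in_range s k) \/
     (exists s t, [/\ s \in Y, t \in Y, s <> t &
        exists y : R, endpoint s (k%:Z, y) /\ endpoint t (k%:Z, y)])).

(* A range may overhang 1..n (it must when n = 1), so the sum runs over the
   indices of the range at which there is data. *)
Definition seg_sqerr x n s : R :=
  \sum_(1 <= k < n.+1 | in_range s k) (x k - approx s k) ^+ 2.

(* The summands are nonnegative, so 0 is a neutral base value for the max. *)
Definition segerr x n Y : R :=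
  \big[Num.max/0]_(s <- Y) seg_sqerr x n s.

Definition sqerr x (i j : nat) s : R :=
  \sum_(i <= k < j.+1) (x k - approx s k) ^+ 2.

(* For i < j, the lines are parametrized by their values at i and j. *)
Definition is_least_squares x (i j : nat) s : Prop :=
  [/\ s.1.1 = i, s.2.1 = j &
      forall y z : R, sqerr x i j s <= sqerr x i j ((i%:Z, y), (j%:Z, z))].

Definition initial_segment x (i : nat) : segment R :=
  ((i%:Z, x i), (i.+1%:Z, x i.+1)).

(* The default value is irrelevant: a least-squares segment exists (and is
   unique) for all i < j. *)
Definition least_squares x (i j : nat) : segment R :=
  xget (initial_segment x i) [set s | is_least_squares x i j s]%classic.

(* The input ends when x_j is not available, i.e. n < j. If x_n starts a new
   segment, that segment is ((n, x_n), (n+1, x_{n+1})), where x_{n+1} is an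
   unspecified real, not a datum. *)
Fixpoint segment_bound_loop x n (eps : R) (fuel i j : nat) s
    : seq (segment R) :=
  if fuel isn't fuel'.+1 then [:: s] else
  if (n < j)%N then [:: s] else
  let s' := least_squares x i j in
  if sqerr x i j s' <= eps
  then segment_bound_loop x n eps fuel' i j.+1 s'
  else s :: segment_bound_loop x n eps fuel' j j.+2 (initial_segment x j).

(* Each iteration increases j, which starts at 3, so [n] units of fuel are never
   exhausted before the input ends. *)
Definition segment_bound x n (eps : R) : {fset segment R} :=
  [fset s in segment_bound_loop x n eps n 1 3 (initial_segment x 1)]%fset.

End PiecewiseLinear.

(* Main.v *)
Require Import Defs.
From HB Require Import structures.
From mathcomp Require Import all_boot all_order all_algebra.
From mathcomp Require Import finmap.
From mathcomp Require Import boolp classical_sets.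
From mathcomp Require Import zify ring lra.

Import Order.TTheory GRing.Theory Num.Theory.
Local Open Scope ring_scope.

(** Let [i_1 < ... < i_m] be the indices at which the output segments start. When
    the segment starting at [i_r] is closed, the least-squares error on
    [i_r .. i_(r+1)] exceeds [eps], so no segment of error at most [eps] has both
    [i_r] and [i_(r+1)] in its range. As ranges are intervals, every competitor
    needs [m] different segments to cover [i_1, ..., i_m]; that it covers each
    index is the only property of a piecewise linear approximation used here. *)

Lemma approx_left (R : realFieldType) (s : segment R) : approx s s.1.1 = s.1.2.
Proof. by rewrite /approx subrr mul0r mul0r addr0. Qed.

Lemma approx_right (R : realFieldType) (s : segment R) :
  wf_segment s -> approx s s.2.1 = s.2.2.
Proof.
rewrite /wf_segment -subr_gt0 => s_wf.
by rewrite /approx divff ?mul1r ?subrKC // intr_eq0 gt_eqF.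
Qed.

(** Two points determine a line. This brings any segment into the form over which [is_least_squares]
    quantifies. *)
Lemma approx_chord (R : realFieldType) (s : segment R) (i j k : int) :
  wf_segment s -> i < j ->
  approx ((i, approx s i), (j, approx s j)) k = approx s k.
Proof.
case: s => -[a y] [b z]; rewrite /wf_segment /approx /= => ltab ltij.
have neab : (b%:~R - a%:~R : R) != 0 by rewrite subr_eq0 eqr_int gt_eqF.
have neij : (j%:~R - i%:~R : R) != 0 by rewrite subr_eq0 eqr_int gt_eqF.
by rewrite !rmorphB /=; field; rewrite neab neij.
Qed.

Lemma seg_sqerr_eq_sqerr (R : realFieldType) (x : nat -> R) (n i j : nat)
    (s : segment R) :
  (1 <= i)%N -> (j <= n)%N -> s.1.1 = i -> s.2.1 = j ->
  seg_sqerr x n s = sqerr x i j s.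
Proof.
move=> i_gt0 lejn si sj; rewrite /seg_sqerr /sqerr.
rewrite (big_nat_widenl i 1) // (big_nat_widen 1 j.+1 n.+1) //.
by apply: eq_bigl => k; rewrite /in_range si sj; lia.
Qed.

(** A range is an interval, so it contains all of [i..j]; the other summands are squares. *)
Lemma sqerr_le_seg_sqerr (R : realFieldType) (x : nat -> R) (n i j : nat)
    (s : segment R) :
  (1 <= i)%N -> (j <= n)%N -> in_range s i -> in_range s j ->
  sqerr x i j s <= seg_sqerr x n s.
Proof.
move=> i_gt0 lejn /andP[si _] /andP[_ sj]; rewrite /seg_sqerr /sqerr.
rewrite (big_nat_widenl i 1) // (big_nat_widen 1 j.+1 n.+1) //.
rewrite [leLHS]big_mkcond [leRHS]big_mkcond; apply: ler_sum => k _.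
case: ifP => kij; last by case: ifP; rewrite ?sqr_ge0.
by rewrite ifT // /in_range; lia.
Qed.

Lemma seg_sqerr_initial (R : realFieldType) (x : nat -> R) (n i : nat) :
  seg_sqerr x n (initial_segment x i) = 0.
Proof.
rewrite /seg_sqerr big1 // => k; rewrite /in_range /= => ki.
have wfi : wf_segment (initial_segment x i) by rewrite /wf_segment /=; lia.
have [->|->] : k = i \/ k = i.+1 by lia.
- by rewrite (approx_left _ (initial_segment x i)) subrr expr0n.
- by rewrite (approx_right _ _ wfi) subrr expr0n.
Qed.

Lemma sum_sqr_centered_gt0 (R : realFieldType) (i j : nat) (c : R) :
  (i < j)%N -> 0 < \sum_(i <= k < j.+1) (k%:R - c) ^+ 2.
Proof.
move=> ltij; rewrite big_ltn 1?big_ltn; try lia.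
rewrite addrA; apply: ltr_wpDr.
  by apply: sumr_ge0 => k _; apply: sqr_ge0.
(* The first two terms suffice: with [u = i - c], [2 * (u^2 + (u + 1)^2) = (2 * u + 1)^2 + 1]. *)
rewrite -natr1; have : 0 <= (2 * (i%:R - c) + 1) ^+ 2 by apply: sqr_ge0.
set a := i%:R; nra.
Qed.

(* Linear regression about the mean [c] of the abscissae: the residuals are
   orthogonal to the constants and to [k - c], hence minimal by Pythagoras. *)
Lemma linear_regression (R : realFieldType) (x : nat -> R) (i j : nat) :
  (i < j)%N -> exists a b : R, forall a' b' : R,
    \sum_(i <= k < j.+1) (x k - (a + b * k%:R)) ^+ 2 <=
    \sum_(i <= k < j.+1) (x k - (a' + b' * k%:R)) ^+ 2.
Proof.
move=> ltij; pose N : R := (j.+1 - i)%:R.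
have N0 : N != 0 by rewrite pnatr_eq0; lia.
pose c := (\sum_(i <= k < j.+1) k%:R) / N.
pose m := (\sum_(i <= k < j.+1) x k) / N.
pose V := \sum_(i <= k < j.+1) (k%:R - c) ^+ 2.
have V0 : V != 0 by rewrite gt_eqF // sum_sqr_centered_gt0.
pose b := (\sum_(i <= k < j.+1) (k%:R - c) * (x k - m)) / V.
have sumc (d : R) : \sum_(i <= k < j.+1) d = d * N.
  by rewrite sumr_const_nat mulr_natr.
pose r k := x k - m - b * (k%:R - c).
have r0 : \sum_(i <= k < j.+1) r k = 0.
  rewrite /r sumrB -mulr_sumr !sumrB !sumc /m /c.
  by field.
have r1 : \sum_(i <= k < j.+1) r k * (k%:R - c) = 0.
  under eq_bigr => k _.
    rewrite (_ : r k * _ = (k%:R - c) * (x k - m) - b * (k%:R - c) ^+ 2);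
      last by rewrite /r; ring.
    over.
  by rewrite sumrB -mulr_sumr -/V /b divfK // subrr.
exists (m - b * c), b => a' b'.
(* The competing line minus the regression line is [p + q * (k - c)], so the competitor's residual
   is [r k - (p + q * (k - c))]. *)
pose p := a' + b' * c - m; pose q := b' - b.
have -> : \sum_(i <= k < j.+1) (x k - (a' + b' * k%:R)) ^+ 2 =
    \sum_(i <= k < j.+1) ((r k) ^+ 2 + (p + q * (k%:R - c)) ^+ 2
      - 2 * p * r k - 2 * q * (r k * (k%:R - c))).
  by apply: eq_bigr => k _; rewrite /r /p /q; ring.
rewrite !sumrB -!mulr_sumr r0 r1 !mulr0 !subr0; apply: ler_sum => k _.
rewrite (_ : x k - _ = r k); last by rewrite /r; ring.
by rewrite lerDl sqr_ge0.
Qed.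

(** As [i] and [j] differ, values at [i] and [j] parametrize the same lines as intercept and slope.
    Regression thus gives a minimizer, and [xget] does not fall back on its default. *)
Lemma least_squaresP (R : realFieldType) (x : nat -> R) (i j : nat) :
  (i < j)%N -> is_least_squares x i j (least_squares x i j).
Proof.
move=> ltij; have [a [b ab_min]] := linear_regression _ x _ _ ltij.
have neij : (j%:R - i%:R : R) != 0 by rewrite subr_eq0 eqr_nat gtn_eqF.
apply: (@xgetPex _ (initial_segment x i) [set s | is_least_squares x i j s]%classic).
exists ((i%:Z, a + b * i%:R), (j%:Z, a + b * j%:R)); split => //= y z.
pose b' := (z - y) / (j%:R - i%:R).
rewrite /sqerr; under eq_bigr => k _.
  rewrite (_ : approx _ _ = a + b * k%:R); last first.
    by rewrite /approx /= !rmorphB /= -!pmulrn; field.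
  over.
under [leRHS]eq_bigr => k _.
  rewrite (_ : approx _ _ = (y - b' * i%:R) + b' * k%:R); last first.
    by rewrite /approx /b' /= !rmorphB /= -!pmulrn; field.
  over.
exact: ab_min.
Qed.

Lemma least_squares_le_seg_sqerr (R : realFieldType) (x : nat -> R)
    (n i j : nat) (s : segment R) :
  (1 <= i)%N -> (i < j)%N -> (j <= n)%N -> in_range s i -> in_range s j ->
  sqerr x i j (least_squares x i j) <= seg_sqerr x n s.
Proof.
move=> i_gt0 ltij lejn si sj.
apply: le_trans (sqerr_le_seg_sqerr _ _ _ _ _ _ i_gt0 lejn si sj).
have [_ _ lsq_min] := least_squaresP _ x _ _ ltij.
apply: le_trans (lsq_min (approx s i) (approx s j)) _.
have s_wf : wf_segment s by move: si sj; rewrite /in_range /wf_segment; lia.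
by rewrite /sqerr; under eq_bigr do rewrite approx_chord //.
Qed.

(** The hypotheses are the loop invariant; [n < j + fuel] ensures that fuel runs out only past the
    end of the input. The bound on [t.1.1] serves uniqueness: segments output after a restart begin
    at [j] or later, beyond the end [j.-1] of the closed one. *)
Lemma segment_bound_loop_valid (R : realFieldType) (x : nat -> R) (n : nat)
    (eps : R) (fuel i j : nat) (s : segment R) :
  0 <= eps -> (1 <= i)%N -> (i.+1 < j)%N -> (n < j + fuel)%N ->
  s.1.1 = i -> s.2.1 = j.-1 -> seg_sqerr x n s <= eps ->
  let L := segment_bound_loop x n eps fuel i j s in
  [/\ forall t : segment R, t \in L ->
        [/\ wf_segment t, seg_sqerr x n t <= eps & (i%:Z <= t.1.1)] &
      forall k : nat, (i <= k <= n)%N -> exists! t : segment R, t \in L /\ in_range t k].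
Proof.
move=> eps_ge0.
elim: fuel i j s => [|fuel IH] i j s i_gt0 ltij ltnj si sj s_err /=.
all: have s_ok : [/\ wf_segment s, seg_sqerr x n s <= eps & i%:Z <= s.1.1]
       by split=> //; rewrite /wf_segment si ?sj; lia.
all: have stop : (n < j)%N -> forall k : nat, (i <= k <= n)%N ->
       exists! t : segment R, t \in [:: s] /\ in_range t k
       by move=> ltj k kin; exists s; split=> [|t [] /[!inE] /eqP->] //;
          rewrite inE eqxx /in_range si sj; split=> //; lia.
  split; last by apply: stop; lia.
  by move=> t /[!inE] /eqP->.
case: ifP => ltj.
  by split; [move=> t /[!inE] /eqP-> | exact: stop].
case: ifP => [ls_err|_].
  have [|ls_i ls_j _] := least_squaresP _ x i j; first lia.
  by apply: IH => //; try lia; rewrite (seg_sqerr_eq_sqerr _ _ _ i j) //; lia.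
have [||||||L_ok L_cov] := IH j j.+2 (initial_segment x j);
  rewrite ?seg_sqerr_initial //; try lia.
split=> [t|k kin].
  rewrite inE => /orP[/eqP-> //|/L_ok[t_wf t_err t_j]]; split=> //; lia.
have [ltkj|lejk] := ltnP k j.
  exists s; split=> [|t []]; first by rewrite inE eqxx /in_range si sj; split=> //; lia.
  by rewrite inE => /orP[/eqP-> //|/L_ok[_ _ t_j]]; rewrite /in_range; lia.
have [|t [[tL tk] t_uniq]] := L_cov k; first lia.
exists t; split=> [|u []]; first by rewrite inE tL orbT.
rewrite inE => /orP[/eqP->|uL uk]; last exact: t_uniq.
by rewrite /in_range si sj; lia.
Qed.

(** The count is a potential that drops at each restart from [i] to [j], because the member of [Y]
    covering [i] ends before [j]. *)
Lemma size_segment_bound_loop_le (R : realFieldType) (x : nat -> R) (n : nat)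
    (eps : R) (Y : seq (segment R)) (fuel i j : nat) (s : segment R) :
  (forall t : segment R, t \in Y -> seg_sqerr x n t <= eps) ->
  (forall k : nat, (1 <= k <= n)%N -> exists2 t : segment R, t \in Y & in_range t k) ->
  (1 <= i <= n)%N -> (i < j)%N ->
  (size (segment_bound_loop x n eps fuel i j s) <=
   count (fun t : segment R => (i%:Z <= t.2.1)%R) Y)%N.
Proof.
move=> Y_err Y_cov; elim: fuel i j s => [|fuel IH] i j s iin ltij /=.
all: have [t tY t_i] := Y_cov i iin.
all: have stop : (0 < count (fun t : segment R => (i%:Z <= t.2.1)%R) Y)%N
       by rewrite -has_count; apply/hasP; exists t => //; case/andP: t_i.
  exact: stop.
case: ifP => [_|lejn]; first exact: stop.
case: ifP => [_|ls_err]; first by apply: IH => //; lia.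
(* Otherwise [t] would contain both [i] and [j], and its error would be at least the rejected
   least-squares error. *)
have t_j : ~~ (j%:Z <= t.2.1).
  apply/negP => t_j; move/negP: ls_err; apply.
  apply: le_trans (Y_err t tY); apply: least_squares_le_seg_sqerr => //; try lia.
  by move: t_i; rewrite /in_range; lia.
have jle : (size (segment_bound_loop x n eps fuel j j.+2 (initial_segment x j))
    <= count (fun t : segment R => (j%:Z <= t.2.1)%R) Y)%N by apply: IH; lia.
apply: leq_ltn_trans jle _.
(* Setting [t] apart, which counts for [i] but not for [j], makes the inequality strict. *)
rewrite !(permP (perm_to_rem tY)) /= (negbTE t_j).
rewrite (_ : i%:Z <= t.2.1); last by case/andP: t_i.
by rewrite add0n add1n ltnS; apply: sub_count => u /=; lia.
Qed.

(** Nonnegativity of [eps] absorbs the base value 0 of the maximum. *)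
Lemma segerr_le (R : realFieldType) (x : nat -> R) (n : nat) (eps : R)
    (Y : {fset segment R}) :
  0 <= eps ->
  segerr x n Y <= eps <-> forall s : segment R, s \in Y -> seg_sqerr x n s <= eps.
Proof.
move=> eps_ge0; rewrite /segerr; split=> [le s sY|le].
  by apply: le_trans le; apply: le_bigmax_seq.
by rewrite big_seq; apply: bigmax_le.
Qed.

(** At a shared endpoint either segment serves, since well-formedness puts endpoints in the
    range. *)
Lemma is_PLA_cover (R : realFieldType) (n : nat) (Y : {fset segment R}) (k : nat) :
  is_PLA n Y -> (1 <= k <= n)%N -> exists2 s : segment R, s \in Y & in_range s k.
Proof.
move=> [Y_wf Y_cov] /Y_cov[[s [[sY sk] _]]|[s [_ [sY _ _ [y [s_end _]]]]]].
  by exists s.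
exists s => //; have := Y_wf s sY; rewrite /wf_segment /in_range.
by case: s_end => <- /=; lia.
Qed.

Theorem theorem4 (R : realFieldType) (n : nat) (x : nat -> R) (eps : R)
    (hn : (1 <= n)%N) (heps : 0 <= eps) :
  segerr x n (segment_bound x n eps) <= eps /\
  ((exists Y : {fset segment R},
      [/\ is_PLA n Y, segerr x n Y <= eps &
          #|` Y|%fset = #|` segment_bound x n eps|%fset]) /\
   (forall Y : {fset segment R},
      is_PLA n Y -> segerr x n Y <= eps ->
      (#|` segment_bound x n eps|%fset <= #|` Y|%fset)%N)).
Proof.
have [||||||L_ok L_cov] := segment_bound_loop_valid _ x n eps n 1 3
  (initial_segment x 1) heps; rewrite ?seg_sqerr_initial //; try lia.
have mem_sb t : (t \in segment_bound x n eps) =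
    (t \in segment_bound_loop x n eps n 1 3 (initial_segment x 1)).
  by rewrite inE.
have sb_err : segerr x n (segment_bound x n eps) <= eps.
  by apply/segerr_le => // t; rewrite mem_sb => /L_ok[].
split=> //; split.
  (* The output itself attains the minimum; each index falls under the exactly-one alternative. *)
  exists (segment_bound x n eps); split=> //; split=> [t|k kin].
    by rewrite mem_sb => /L_ok[].
  left; have [t [[tL tk] t_uniq]] := L_cov k kin.
  by exists t; split=> [|u]; rewrite mem_sb //; apply: t_uniq.
move=> Y Y_PLA /segerr_le-/(_ heps) Y_err.
have le_size : (size (segment_bound_loop x n eps n 1 3 (initial_segment x 1))
    <= count (fun t : segment R => (1%:Z <= t.2.1)%R) Y)%N.
  apply: size_segment_bound_loop_le => //.
  by move=> k kin; apply: is_PLA_cover Y_PLA kin.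
apply: leq_trans (leq_trans _ le_size) (count_size _ _).
(* Turning the output list into a finite set cannot increase its size. *)
apply: uniq_leq_size; first exact: fset_uniq.
by move=> t; rewrite mem_sb.
Qed.
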